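(* Let $q$ be a prime power and let $e\geq d\geq 3$ be integers. Let $\Gamma$ be a distance-regular graph with the same intersection array as the bilinear forms graph $Bil_q(d\times e)$. Let $\eta$ be a non-principal eigenvalue of the local graph of a vertex of $\Gamma$. Then $\eta$ satisfies \[ -q-1\leq \eta\leq -1\quad\text{or}\quad q^d-q-1\leq \eta\leq q^e-q-1. \]
   Context: All graphs are finite, undirected and simple. The bilinear forms graph $Bil_q(d\times e)$ ($e\geq d\geq 2$) has as vertices all $(d\times e)$-matrices over $\mathbb{F}_q$, two matrices being adjacent if and only if the rank of their difference equals $1$. Let $\Gamma$ be a connected graph with diameter $D$ and path-length distance $\partial$; let $\Gamma_i(x)$ be the set of vertices at distance exactly $i$ from $x$, and $\Gamma(x)=\Gamma_1(x)$ (with $\Gamma_{-1}(x)=\Gamma_{D+1}(x)=\emptyset$). The local graph of $x$ is the subgraph induced on $\Gamma(x)$. For $x,y$ with $\partial(x,y)=i$ put $c_i(x,y)=|\Gamma(y)\cap\Gamma_{i-1}(x)|$, $a_i(x,y)=|\Gamma(y)\cap\Gamma_i(x)|$, $b_i(x,y)=|\Gamma(y)\cap\Gamma_{i+1}(x)|$; such a number is well-defined if it does not depend on the choice of $x,y$ at distance $i$. The graph $\Gamma$ is distance-regular if $c_i$, $a_i$, $b_{i-1}$ are well-defined for all $1\leq i\leq D$; its intersection array is then $\{b_0,\ldots,b_{D-1};c_1,\ldots,c_D\}$. It is a known fact that $Bil_q(d\times e)$, $e\geq d$, is distance-regular with diameter $d$ and intersection array given, for $1\leq j\leq d$, by $b_{j-1}=q^{2j-2}(q-1)\frac{q^{d-j+1}-1}{q-1}\cdot\frac{q^{e-j+1}-1}{q-1}$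 and $c_j=q^{j-1}\frac{q^j-1}{q-1}$. The eigenvalues of a graph are those of its adjacency matrix. An eigenvalue is called non-principal if its eigenspace contains a (nonzero) vector orthogonal to the all-one vector. *)

(* Defs.v *)
From HB Require Import structures.
From mathcomp Require Import all_boot all_order all_algebra.

Set Implicit Arguments.
Unset Strict Implicit.
Unset Printing Implicit Defensive.

Import GRing.Theory Num.Theory.

Section Graphs.
Variables (T : finType) (adj : rel T).

Definition simple_graph := symmetric adj /\ irreflexive adj.

Definition connected_graph := forall x y, connect adj x y.

Definition walk_of_length (n : nat) (x y : T) : bool :=
  [exists p : n.-tuple T, path adj x p && (last x p == y)].

(* Shortest walks have length < #|T|, so the search range is sufficient; the  *)
(* value is #|T| when x and y lie in different components.                    *)
Definition dist (x y : T) : nat :=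
  find (fun n => walk_of_length n x y) (iota 0 #|T|).

Definition diameter : nat := \max_(x : T) \max_(y : T) dist x y.

Definition sphere (i : nat) (x : T) : {set T} := [set z | dist x z == i].

(* The intersection numbers of (x, y) at index i = dist x y. In c_num the     *)
(* index i - 1 is written so that the set is empty when i = 0.                *)
Definition c_num (x y : T) : nat :=
  #|sphere 1 y :&: [set z | (dist x z).+1 == dist x y]|.
Definition a_num (x y : T) : nat := #|sphere 1 y :&: sphere (dist x y) x|.
Definition b_num (x y : T) : nat := #|sphere 1 y :&: sphere (dist x y).+1 x|.

Definition well_defined_at (f : T -> T -> nat) (i : nat) : Prop :=
  forall x y x' y', dist x y = i -> dist x' y' = i -> f x y = f x' y'.

Definition distance_regular : Prop :=
  [/\ simple_graph, connected_graph &
      forall i, 1 <= i <= diameter ->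
        [/\ well_defined_at c_num i, well_defined_at a_num i &
            well_defined_at b_num i.-1]].

(* bs = [:: b_0; ...; b_(D-1)] and cs = [:: c_1; ...; c_D], so that c_i is    *)
(* the item of cs of position i - 1.                                          *)
Definition has_intersection_array (bs cs : seq nat) : Prop :=
  [/\ size bs = diameter, size cs = diameter,
      forall x y, dist x y < diameter -> b_num x y = nth 0 bs (dist x y) &
      forall x y, 0 < dist x y -> c_num x y = nth 0 cs (dist x y).-1].

Definition induced (A : {set T}) : rel {z : T | z \in A} :=
  fun u v => adj (val u) (val v).

Definition local_graph (x : T) : rel {z : T | z \in sphere 1 x} :=
  induced (A := sphere 1 x).

End Graphs.

Arguments local_graph {T} adj x.

Definition same_intersection_array (T T' : finType)
    (adj : rel T) (adj' : rel T') : Prop :=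
  exists bs cs : seq nat,
    has_intersection_array adj bs cs /\ has_intersection_array adj' bs cs.

Definition bilinear_forms_graph (F : finFieldType) (d e : nat) :
    rel 'M[F]_(d, e) :=
  fun X Y => \rank (X - Y)%R == 1.

Arguments bilinear_forms_graph F d e : clear implicits.

Section Spectrum.
Local Open Scope ring_scope.
Variables (R : fieldType) (V : finType) (adj : rel V).

Definition adjacency_matrix : 'M[R]_#|V| :=
  \matrix_(i, j) (adj (enum_val i) (enum_val j))%:R.

Definition nonprincipal_eigenvalue (eta : R) : Prop :=
  eigenvalue adjacency_matrix eta /\
  exists v : 'rV[R]_#|V|,
    [/\ v != 0, (v <= eigenspace adjacency_matrix eta)%MS &
        v *m (const_mx 1 : 'cV[R]_#|V|) = 0].

End Spectrum.

(* Main.v *)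
Require Import Defs.
From mathcomp Require Import all_boot all_order all_algebra.
From mathcomp Require Import mxabelem ring lra.

Set Implicit Arguments.
Unset Strict Implicit.
Unset Printing Implicit Defensive.

Import Order.TTheory GRing.Theory Num.Theory.

(* Let v be an eta-eigenvector of the local graph of x, with sum 0, extended by
   0; let A be the adjacency matrix and E the (unnormalized) first primitive
   idempotent, whose entries are affine in q^-dist. On the sphere S of radius 2
   about x, apply the Cauchy-Schwarz inequality to A v and E v. The numbers
   |A v|^2 and <A v, E v> on S are elementary, because E v = lambda v on the
   sphere of radius 1 with lambda affine in eta. The Q-polynomial property
   (the entries of the second idempotent are quadratic in q^-dist) makes the
   diagonal matrix 1_S congruent, modulo matrices M such that E M E = 0, to a
   combination of 1_{x}, 1_{sphere of radius 1} and the identity, which gives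
   |E v|^2 on S. The resulting inequality says that a cubic with roots -1,
   q^d-q-1 and q^e-q-1 is nonpositive, or that lambda = 0, that is eta = -q-1;
   and lambda >= 0 because E is positive semidefinite. *)

Lemma sum_indicator (R : pzSemiRingType) (T : finType) (F : T -> R)
  (P : pred T) :
  (\sum_z (P z)%:R * F z = \sum_(z | P z) F z)%R.
Proof.
rewrite [RHS]big_mkcond; apply: eq_bigr => z _.
by case: (P z); rewrite ?mul1r ?mul0r.
Qed.

(** * Eigensequences and radial sums *)

Section RadialSums.
Local Open Scope ring_scope.
Variables (R : realFieldType) (T : finType) (D : T -> T -> nat).
Variables (k : R) (b c : nat -> R).

Hypothesis D_sym : forall y z, D y z = D z y.
Hypothesis D_eq0 : forall y z, (D y z == 0%N) = (y == z).
Hypothesis c0 : c 0 = 0.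
Hypothesis cS_neq0 : forall i, c i.+1 != 0.
(** Distance-regularity in operator form: among the neighbours of [y], [c] lie one step closer to
    [u], [b] one step farther and the other [k - b - c] at the same distance. At [D u y = 0] the
    truncated [.-1] is harmless because of [c0]. *)
Hypothesis nbr_sum : forall (g : nat -> R) u y,
  \sum_(z | D y z == 1%N) g (D u z) =
    c (D u y) * g (D u y).-1 + (k - b (D u y) - c (D u y)) * g (D u y)
    + b (D u y) * g (D u y).+1.

(** The unnormalized cosine sequence of an eigenvalue [theta]. The recurrence is required at every
    index, also beyond the diameter. *)
Definition eigenseq (theta : R) (w : nat -> R) :=
  forall i, c i * w i.-1 + (k - b i - c i) * w i + b i * w i.+1 = theta * w i.

Lemma degree y : \sum_(z | D y z == 1%N) 1 = k.
Proof. by rewrite (nbr_sum (fun=> 1) y y); ring. Qed.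

Lemma eigenseq_nbr theta w u y : eigenseq theta w ->
  \sum_(z | D y z == 1%N) w (D u z) = theta * w (D u y).
Proof. by move=> w_eig; rewrite nbr_sum w_eig. Qed.

(** The identity A A_{i+1} = c_{i+2} A_{i+2} + a_{i+1} A_{i+1} + b_i A_i between distance matrices,
    applied to [F]. The coefficient of each [F z] comes from [nbr_sum] for an indicator function. *)
Lemma sphere_sum_rec (F : T -> R) i y :
  \sum_(y' | D y y' == 1%N) \sum_(z | D y' z == i.+1) F z =
    c i.+2 * (\sum_(z | D y z == i.+2) F z)
    + (k - b i.+1 - c i.+1) * (\sum_(z | D y z == i.+1) F z)
    + b i * (\sum_(z | D y z == i) F z).
Proof.
rewrite -3!(sum_indicator F)
  (exchange_big_dep predT) //= !mulr_sumr -!big_split /=.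
apply: eq_bigr => z _.
transitivity (F z * \sum_(y' | D y y' == 1%N) (D z y' == i.+1)%:R).
  rewrite mulr_sumr big_mkcondr; apply: eq_bigr => y' _.
  by rewrite D_sym; case: eqP; rewrite ?mulr1 ?mulr0.
rewrite (nbr_sum (fun j => (j == i.+1)%:R)) [D y z]D_sym.
case: (D z y) => [|j] /=; first by rewrite c0; case: i => [|i] /=; ring.
rewrite !eqSS.
case: (j =P i.+1) => [->|_].
  have -> : (i.+1 == i) = false by rewrite gtn_eqF.
  have -> : (i.+2 == i) = false by rewrite gtn_eqF.
  by rewrite /=; ring.
case: (j =P i) => [->|_].
  have -> : (i.+1 == i) = false by rewrite gtn_eqF.
  by rewrite /=; ring.
by case: eqP => [<-|_] /=; ring.
Qed.

(** Each distance matrix is a polynomial in A, so it acts as a scalar on the eigenvectors given by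
    [w]. *)
Lemma sphere_sum theta w (w_eig : eigenseq theta w) i :
  exists p, forall y u, \sum_(z | D y z == i) w (D z u) = p * w (D y u).
Proof.
(* The recurrence has order two, so the induction carries two consecutive radii. *)
suff [] : (exists p, forall y u, \sum_(z | D y z == i) w (D z u) = p
  * w (D y u)) /\
   (exists p, forall y u, \sum_(z | D y z == i.+1) w (D z u) = p
     * w (D y u)) by [].
elim: i => [|i [[p0 Hp0] [p1 Hp1]]]; split.
- exists 1 => y u; rewrite mul1r (big_pred1 y) // => z.
  by rewrite D_eq0 eq_sym.
- exists theta => y u; rewrite D_sym -(eigenseq_nbr u y w_eig).
  by apply: eq_bigr => z _; rewrite D_sym.
- by exists p1.
exists ((theta * p1 - (k - b i.+1 - c i.+1) * p1 - b i * p0) / c i.+2) => y u.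
have := sphere_sum_rec (fun z => w (D z u)) i y.
rewrite Hp0 Hp1 (eq_bigr (fun y' => p1 * w (D u y'))); last first.
  by move=> y' _; rewrite Hp1 D_sym.
rewrite -mulr_sumr (eigenseq_nbr u y w_eig) [D u y]D_sym => E.
apply: (mulfI (cS_neq0 i.+1)).
transitivity (p1 * (theta * w (D y u)) - (k - b i.+1 - c i.+1) * (p1
  * w (D y u)) - b i * (p0 * w (D y u))); first by rewrite E; ring.
by field; rewrite cS_neq0.
Qed.

Lemma radial_sum theta w (w_eig : eigenseq theta w) (phi : nat -> R) :
  exists p, forall y u, \sum_z phi (D y z) * w (D z u) = p * w (D y u).
Proof.
pose N := \max_(y : T) \max_(z : T) D y z.
have DN y z : (D y z < N.+1)%N.
  by rewrite ltnS (leq_trans (leq_bigmax z)) //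
    (leq_bigmax (F := fun y => \max_z D y z)).
have /fin_all_exists [p Hp] (i : 'I_N.+1) := sphere_sum w_eig i.
exists (\sum_(i < N.+1) phi i * p i) => y u.
rewrite (partition_big (fun z => Ordinal (DN y z)) predT) //= mulr_suml.
apply: eq_bigr => i _; rewrite -mulrA -Hp mulr_sumr.
by apply: eq_big => z //=; move=> /eqP <-.
Qed.

Lemma eigenseq_sum0 theta w (w_eig : eigenseq theta w) x :
  theta != k -> \sum_z w (D x z) = 0.
Proof.
move=> theta_k; apply/eqP; rewrite -(mulrI_eq0 _ (x := theta - k)); last first.
  by apply/mulfI; rewrite subr_eq0.
apply/eqP; rewrite mulrBl; apply/eqP; rewrite subr_eq0; apply/eqP.
rewrite mulr_sumr; under eq_bigr do rewrite -(eigenseq_nbr _ _ w_eig).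
rewrite (exchange_big_dep predT) //= mulr_sumr; apply: eq_bigr => z _.
by rewrite -(degree z) mulr_suml; apply: eq_big => [y|y _];
  [rewrite D_sym | rewrite mul1r].
Qed.

(** By [radial_sum] the sum is [p * w (D x u)]; the case [u = x], where [w 0 != 0], forces
    [p = 0]. *)
Lemma radial_orthogonal theta w (w_eig : eigenseq theta w) (w0 : w 0 != 0)
    (phi : nat -> R) x :
  \sum_z phi (D x z) * w (D x z) = 0 ->
  forall u, \sum_z phi (D x z) * w (D z u) = 0.
Proof.
have [p Hp] := radial_sum w_eig phi; move=> phi_w u; rewrite Hp.
move: (Hp x x); rewrite (eqP (_ : D x x == 0%N)) ?D_eq0 //.
under eq_bigr do rewrite [D _ x]D_sym.
by rewrite phi_w => /esym/eqP; rewrite mulf_eq0 (negPf w0) orbF => /eqP->;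
  rewrite mul0r.
Qed.

(** No triangle inequality is assumed for [D]: it follows from [nbr_sum] for the indicator of the
    indices above [(D u y).+1], whose right-hand side vanishes. *)
Lemma dist_nbr_le u y z : D y z = 1%N -> (D u z <= (D u y).+1)%N.
Proof.
move=> yz1; have := nbr_sum (fun j => ((D u y).+1 < j)%:R) u y.
rewrite !ltnn !ltnNge leqnSn (leq_trans (leq_pred _)) ?leqnSn //= !mulr0 !addr0.
move/eqP; rewrite psumr_eq0 => [/allP/(_ z)|]; last by move=> *; apply: ler0n.
by rewrite mem_index_enum yz1 eqxx pnatr_eq0 eqb0 -leqNgt; apply.
Qed.

Lemma sphere2_card y : c 1 = 1 -> b 0 = k -> 
  c 2 * (\sum_(z | D y z == 2%N) 1) = k * b 1.
Proof.
move=> c1 b0; have := sphere_sum_rec (fun=> 1) 0 y.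
rewrite (eq_bigr (fun=> k * 1)) => [|z _]; last by rewrite degree mulr1.
have -> : \sum_(z | D y z == 0%N) 1 = 1 :> R.
  by rewrite (big_pred1 y) // => z; rewrite D_eq0 eq_sym.
rewrite -mulr_sumr degree c1 b0 => E.
transitivity (k * k - (k - b 1 - 1) * k - k * 1); first by rewrite E; ring.
by ring.
Qed.

Lemma sum_ball2 y (F : T -> R) : (forall z, (2 < D y z)%N -> F z = 0) ->
  \sum_z F z =
    F y + \sum_(z | D y z == 1%N) F z + \sum_(z | D y z == 2%N) F z.
Proof.
move=> F0; have -> : F y = \sum_z (D y z == 0%N)%:R * F z.
  by rewrite sum_indicator (big_pred1 y) // => z; rewrite D_eq0 eq_sym.
rewrite -(sum_indicator F (fun z => D y z == 1%N)).
rewrite -(sum_indicator F (fun z => D y z == 2%N)) -!big_split.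
apply: eq_bigr => z _ /=; have := F0 z.
by case: (D y z) => [|[|[|j]]] /= Fz; last rewrite Fz //; ring.
Qed.

Definition nbr_op (f : T -> R) y := \sum_(z | D y z == 1%N) f z.

Lemma nbr_op_adjoint f g : \sum_y f y * nbr_op g y = \sum_y nbr_op f y * g y.
Proof.
under eq_bigr do rewrite mulr_sumr.
rewrite (exchange_big_dep predT) //=; apply: eq_bigr => z _.
by rewrite mulr_suml; apply: eq_bigl => y; rewrite D_sym.
Qed.

Definition kernel_op (w : nat -> R) (f : T -> R) y := \sum_z w (D y z) * f z.

Lemma kernel_op_adjoint w f g :
  \sum_y f y * kernel_op w g y = \sum_y kernel_op w f y * g y.
Proof.
under eq_bigr do rewrite mulr_sumr.
rewrite exchange_big /=; apply: eq_bigr => z _.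
by rewrite mulr_suml; apply: eq_bigr => y _; rewrite D_sym; ring.
Qed.

Lemma nbr_kernel_op theta w f y : eigenseq theta w ->
  nbr_op (kernel_op w f) y = theta * kernel_op w f y.
Proof.
move=> w_eig; rewrite /nbr_op /kernel_op exchange_big mulr_sumr /=.
apply: eq_bigr => z _; rewrite -mulr_suml mulrA [D y z]D_sym.
rewrite -(eigenseq_nbr _ _ w_eig); congr (_ * _).
by apply: eq_bigr => y' _; rewrite D_sym.
Qed.

Lemma kernel_kernel_op w p f y :
  (forall y u, \sum_z w (D y z) * w (D z u) = p * w (D y u)) ->
  kernel_op w (kernel_op w f) y = p * kernel_op w f y.
Proof.
move=> Hp; rewrite /kernel_op; under eq_bigr do rewrite mulr_sumr.
rewrite exchange_big mulr_sumr /=; apply: eq_bigr => z _.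
by rewrite mulrA -Hp mulr_suml; apply: eq_bigr => u _; rewrite mulrA.
Qed.

(* With [W] the matrix of entries [w (D y z)] and [W^2 = p W], the squared
   Frobenius norm of [W diag(phi) W] is [p^2] times the sum of
   [phi z * phi z' * w (D z z')^2]. *)
Lemma triple_product_eq0 theta w (w_eig : eigenseq theta w) (phi : T -> R) f :
  (forall u, \sum_z phi z * w (D z u) ^+ 2 = 0) ->
  \sum_z phi z * kernel_op w f z ^+ 2 = 0.
Proof.
have [p Hp] := radial_sum w_eig w; move=> phi_w2.
pose G y u := \sum_z phi z * w (D y z) * w (D z u).
have G0 y u : G y u = 0.
  have : \sum_(yu : T * T) G yu.1 yu.2 ^+ 2 = 0.
    rewrite -(pair_bigA _ (fun y u => G y u ^+ 2)) /=.
    transitivity (\sum_z \sum_z' phi z * phi z' * (p * w (D z z')) ^+ 2).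
      transitivity (\sum_y \sum_u \sum_z \sum_z' (phi z * phi z' *
          (w (D z y) * w (D y z')) * (w (D z u) * w (D u z')))).
        apply: eq_bigr => y1 _; apply: eq_bigr => u1 _; rewrite expr2 mulr_suml.
        apply: eq_bigr => z _; rewrite mulr_sumr; apply: eq_bigr => z' _.
        by rewrite [D y1 z]D_sym [D z' u1]D_sym; ring.
      under eq_bigr do rewrite exchange_big.
      rewrite exchange_big; apply: eq_bigr => z _ /=.
      under eq_bigr do rewrite exchange_big.
      rewrite exchange_big; apply: eq_bigr => z' _ /=.
      rewrite expr2 -Hp mulr_suml mulr_sumr; apply: eq_bigr => y1 _.
      by rewrite !mulr_sumr; apply: eq_bigr => u1 _; ring.
    rewrite big1 // => z _;
      transitivity (phi z * p ^+ 2 * \sum_z' phi z' * w (D z' z) ^+ 2).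
      by rewrite mulr_sumr; apply: eq_bigr => z' _; rewrite [D z z']D_sym; ring.
    by rewrite phi_w2 mulr0.
  move/eqP; rewrite psumr_eq0 => [/allP/(_ (y, u))|]; last by move=> *;
    apply: sqr_ge0.
  by rewrite mem_index_enum sqrf_eq0 => /(_ isT)/eqP.
(* The sum in question is the quadratic form of [G], the matrix W diag(phi) W, at [f]. *)
transitivity (\sum_y \sum_u f y * f u * G y u); last first.
  by rewrite big1 // => y _; rewrite big1 // => u _; rewrite G0 mulr0.
transitivity (\sum_z \sum_y \sum_u phi z * (w (D z y) * f y) * (w (D z u)
  * f u)).
  apply: eq_bigr => z _; rewrite /kernel_op expr2 mulr_suml mulr_sumr.
  apply: eq_bigr => y _; rewrite !mulr_sumr.
  by apply: eq_bigr => u _; ring.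
rewrite exchange_big; apply: eq_bigr => y _ /=.
rewrite exchange_big; apply: eq_bigr => u _ /=.
by rewrite mulr_sumr; apply: eq_bigr => z _; rewrite [D z y]D_sym; ring.
Qed.

End RadialSums.

(** Lagrange's identity: the double sum of squares below is twice the difference of the two
    sides. *)
Lemma sum_Cauchy_Schwarz (R : realFieldType) (I : finType) (P : pred I)
    (f g : I -> R) :
  ((\sum_(i | P i) f i * g i) ^+ 2 <=
    (\sum_(i | P i) f i * f i) * (\sum_(i | P i) g i * g i))%R.
Proof.
set A := (\sum_(i | P i) f i * f i)%R; set B := (\sum_(i | P i) g i * g i)%R.
set C := (\sum_(i | P i) f i * g i)%R.
have : (0 <= \sum_(i | P i) \sum_(j | P j) (f i * g j - f j * g i) ^+ 2)%R.
  by apply: sumr_ge0 => i _; apply: sumr_ge0 => j _; apply: sqr_ge0.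
have -> : (\sum_(i | P i) \sum_(j | P j) (f i * g j - f j * g i) ^+ 2 =
    A * B + B * A - 2 * (C * C))%R.
  rewrite /A /B {1 2}/C !mulr_suml mulr_sumr -big_split -sumrB.
  apply: eq_bigr => i _ /=; rewrite !mulr_sumr -big_split -sumrB.
  by apply: eq_bigr => j _ /=; ring.
by rewrite expr2; lra.
Qed.

(** * Local eigenvalues for the bilinear forms array *)

Section BilinearArray.
Local Open Scope ring_scope.
Variables (R : realFieldType) (q Q P : R).

(** With [Q] = q^d and [P] = q^e these are the entries of the array. Keeping [Q] and [P] as
    independent variables turns the later computations into rational identities. *)
Definition bil_b i := (Q - q ^+ i) * (P - q ^+ i) / (q - 1).
Definition bil_c i := q ^+ i.-1 * (q ^+ i - 1) / (q - 1).

Hypotheses (q_gt1 : 1 < q) (Q_gt : q ^+ 2 < Q) (P_ge : Q <= P).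

Let q_gt0 : 0 < q. Proof. exact: lt_trans ltr01 q_gt1. Qed.
Let Q_gt1 : 1 < Q. Proof. by apply: lt_trans Q_gt; rewrite exprn_egt1. Qed.
Let P_gt1 : 1 < P. Proof. exact: lt_le_trans Q_gt1 P_ge. Qed.
Let q_neq0 : q != 0. Proof. exact: lt0r_neq0. Qed.
Let q1_neq0 : q - 1 != 0. Proof. by rewrite subr_eq0 gt_eqF. Qed.
Let qp1_neq0 : q + 1 != 0. Proof. by apply/lt0r_neq0/addr_gt0. Qed.
Let qq1_neq0 : q ^+ 2 - 1 != 0. Proof. by rewrite subr_eq0 gt_eqF //
  exprn_egt1. Qed.
Let Q_neq0 : Q != 0. Proof. exact/lt0r_neq0/(lt_trans ltr01). Qed.
Let P_neq0 : P != 0. Proof. exact/lt0r_neq0/(lt_trans ltr01). Qed.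
Let Q1_neq0 : Q - 1 != 0. Proof. by rewrite subr_eq0 gt_eqF. Qed.
Let P1_neq0 : P - 1 != 0. Proof. by rewrite subr_eq0 gt_eqF. Qed.

Lemma bil_c0 : bil_c 0 = 0. Proof. by rewrite /bil_c expr0 subrr mulr0 mul0r. Qed.

Lemma bil_c1 : bil_c 1 = 1.
Proof. by rewrite /bil_c; field. Qed.

Lemma bil_cS_neq0 i : bil_c i.+1 != 0.
Proof.
rewrite /bil_c !mulf_neq0 ?invr_eq0 ?expf_neq0 //.
by rewrite subr_eq0 gt_eqF // exprn_egt1.
Qed.

(* The first two nontrivial columns of the dual eigenmatrix, up to scaling:
   polynomials of degree 1 and 2 in [q^-i]. *)
Definition bil_h := - (Q + P - 1) / (Q * P).
Definition bil_r := - (q + 1) * (Q + P - q) / (Q * P).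
Definition bil_s := - (q ^+ 2 - 1 + bil_r * q * (Q + P - 1)) / ((q
  + 1) * Q * P).
Definition bil_w1 i := (q ^+ i)^-1 + bil_h.
Definition bil_w2 i := (q ^+ i)^-1 ^+ 2 + bil_r * (q ^+ i)^-1 + bil_s.

(** With y = q^i the recurrence is a rational identity; index 0 is apart because [.-1] is truncated
    there. *)
Lemma bil_w1_eig :
  eigenseq (bil_b 0) bil_b bil_c (bil_b 0 - Q * P / q) bil_w1.
Proof.
case=> [|i]; rewrite /bil_w1 /bil_h /bil_b /bil_c /= !exprS ?expr0.
  by field; do ?[apply/andP; split].
have y_neq0 : q ^+ i != 0 by rewrite expf_neq0.
by field; do ?[apply/andP; split].
Qed.

Lemma bil_w2_eig :
  eigenseq (bil_b 0) bil_b bil_c (bil_b 0 - (q + 1) * Q * P / q ^+ 2) bil_w2.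
Proof.
case=> [|i]; rewrite /bil_w2 /bil_s /bil_r /bil_b /bil_c /= !exprS ?expr0.
  by field; do ?[apply/andP; split].
have y_neq0 : q ^+ i != 0 by rewrite expf_neq0.
by field; do ?[apply/andP; split].
Qed.

Definition bil_z0 := (q - 1) * (Q - 1) * (P - 1) / (Q * P) ^+ 2.

(** The Q-polynomial property in the form needed: the square of an affine function of q^-i is a
    combination of [bil_w2], [bil_w1] and 1. *)
Lemma bil_w1_sqr i :
  bil_w1 i ^+ 2 = bil_w2 i + (2 * bil_h - bil_r) * bil_w1 i + bil_z0.
Proof.
have y_neq0 : q ^+ i != 0 by rewrite expf_neq0.
rewrite /bil_w1 /bil_w2 /bil_z0 /bil_s /bil_r /bil_h.
by field; do ?[apply/andP; split].
Qed.

Definition bil_lambda eta := (q - 1) / q ^+ 2 * (eta + q + 1).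

(** The factors 1, [eta] and [- 1 - eta] are the sums of v over the spheres of radius 0, 1, 2 about
    a neighbour y of x, relative to v(y). They add up to 0, so [bil_h] cancels. *)
Lemma bil_lambdaE eta :
  bil_lambda eta =
    bil_w1 0 * 1 + bil_w1 1 * eta + bil_w1 2 * (- 1 - eta).
Proof.
by rewrite /bil_lambda /bil_w1 expr0 expr1; field; do ?[apply/andP; split].
Qed.

(* These constants make [bil_phi], defined below, orthogonal to the constants,
   to [bil_w1] and to [bil_w2]. *)
Definition bil_beta := (Q - q ^+ 2) * (P - q ^+ 2) / ((q - 1) * q ^+ 3) - 1.
Definition bil_k2 := bil_b 0 * bil_b 1 / bil_c 2.
Definition bil_g := (Q * P) ^+ 2 / q ^+ 4.
Definition bil_alpha := bil_k2 - bil_beta * bil_b 0 - bil_g.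

Lemma bil_alpha_w1 :
  bil_k2 * bil_w1 2 - bil_alpha * bil_w1 0 - bil_beta * bil_b 0 * bil_w1 1 = 0.
Proof.
rewrite /bil_alpha /bil_k2 /bil_g /bil_beta /bil_w1 /bil_h /bil_b /bil_c /=.
by rewrite !expr0 !expr1; field; do ?[apply/andP; split].
Qed.

Lemma bil_alpha_w2 :
  bil_k2 * bil_w2 2 - bil_alpha * bil_w2 0 - bil_beta * bil_b 0 * bil_w2 1 = 0.
Proof.
rewrite /bil_alpha /bil_k2 /bil_g /bil_beta /bil_w2 /bil_s /bil_r /bil_b /bil_c /=.
by rewrite !expr0 !expr1; field; do ?[apply/andP; split].
Qed.

(* Times [bil_lambda eta], the left-hand side is, up to a positive factor, the
   Terwilliger polynomial of the array. *)
Lemma terwilliger_cubic eta :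
  (bil_b 0 + (bil_b 0 - bil_b 1 - 1) * eta + bil_c 2 * (- 1 - eta) - eta ^+ 2)
     * (bil_beta * bil_lambda eta + Q * P * (q - 1) / q ^+ 4)
   - (bil_b 0 - Q * P / q - eta) ^+ 2 * bil_lambda eta =
  - ((Q - q ^+ 2) * (P - q ^+ 2) / q ^+ 5)
    * ((eta + 1) * (eta - (Q - q - 1)) * (eta - (P - q - 1))).
Proof.
rewrite /bil_beta /bil_lambda /bil_b /bil_c /=.
by rewrite !expr0 !expr1; field; do ?[apply/andP; split].
Qed.

(** Positivity of [bil_lambda eta] means [eta] > -q-1, and [Q_gt] makes the factor in front of the
    cubic positive. The cubic is thus nonpositive: [eta] is at most -1 or lies between the two
    larger roots. *)
Lemma cubic_bounds eta :
  0 < bil_lambda eta ->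
  (bil_b 0 - Q * P / q - eta) ^+ 2 * bil_lambda eta <=
    (bil_b 0 + (bil_b 0 - bil_b 1 - 1) * eta + bil_c 2 * (- 1 - eta) - eta ^+ 2)
     * (bil_beta * bil_lambda eta + Q * P * (q - 1) / q ^+ 4) ->
  (- q - 1 <= eta <= -1) \/ (Q - q - 1 <= eta <= P - q - 1).
Proof.
move=> lam_gt0; rewrite -subr_ge0 terwilliger_cubic mulNr oppr_ge0.
have f_gt0 : 0 < (Q - q ^+ 2) * (P - q ^+ 2) / q ^+ 5.
  by rewrite divr_gt0 ?exprn_gt0 ?mulr_gt0 // subr_gt0 // (lt_le_trans Q_gt).
rewrite pmulr_rle0 // => cubic_le0.
have eta_gt : 0 < eta + q + 1.
  by move: lam_gt0; rewrite pmulr_rgt0 // divr_gt0 ?exprn_gt0 ?subr_gt0.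
have qQ : q < Q by apply: le_lt_trans Q_gt; rewrite -[leLHS]expr1 ler_eXn2l.
case: (lerP eta (-1)) => [|eta1]; first by left; lra.
right; have : (eta - (Q - q - 1)) * (eta - (P - q - 1)) <= 0.
  by move: cubic_le0; rewrite -mulrA pmulr_rle0 //; lra.
set a := eta - (Q - q - 1); set a' := eta - (P - q - 1) => aa'.
have a'a : a' <= a by have := P_ge; rewrite /a /a'; lra.
have a_ge0 : 0 <= a.
  by rewrite leNgt; apply/negP => a_lt0; have a'_lt0 := le_lt_trans a'a a_lt0;
    nra.
have a'_le0 : a' <= 0.
  by rewrite leNgt; apply/negP => a'_gt0; have a_gt0 := lt_le_trans a'_gt0 a'a;
    nra.
by move: a_ge0 a'_le0; rewrite /a /a'; lra.
Qed.

(** * Idempotent identities in a graph with this array *)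

Variables (T : finType) (D : T -> T -> nat).
Hypothesis D_sym : forall y z, D y z = D z y.
Hypothesis D_eq0 : forall y z, (D y z == 0%N) = (y == z).
Hypothesis nbr_sum : forall (g : nat -> R) u y,
  \sum_(z | D y z == 1%N) g (D u z) =
    bil_c (D u y) * g (D u y).-1
    + (bil_b 0 - bil_b (D u y) - bil_c (D u y)) * g (D u y)
    + bil_b (D u y) * g (D u y).+1.

Let D_refl y : D y y = 0%N. Proof. by apply/eqP; rewrite D_eq0. Qed.
Let n : R := #|T|%:R.

Lemma sum_bil_w1 x : \sum_z bil_w1 (D x z) = 0.
Proof.
apply: (eigenseq_sum0 D_sym nbr_sum bil_w1_eig).
by rewrite -subr_eq0 [_ - _ - _]addrC addKr oppr_eq0 !mulf_neq0 ?invr_eq0.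
Qed.

Lemma sum_bil_w2 x : \sum_z bil_w2 (D x z) = 0.
Proof.
apply: (eigenseq_sum0 D_sym nbr_sum bil_w2_eig).
by rewrite -subr_eq0 [_ - _ - _]addrC addKr oppr_eq0 !mulf_neq0 ?invr_eq0 ?expf_neq0.
Qed.

Lemma bil_w10_neq0 : bil_w1 0 != 0.
Proof.
have -> : bil_w1 0 = (Q - 1) * (P - 1) / (Q * P).
  by rewrite /bil_w1 /bil_h expr0; field; apply/andP.
by rewrite !mulf_neq0 ?invr_eq0 ?mulf_neq0.
Qed.

Lemma bil_w20_neq0 : bil_w2 0 != 0.
Proof.
have -> : bil_w2 0 = (Q - 1) * (P - 1) * (Q - q) * (P - q) / (Q * P) ^+ 2.
  by rewrite /bil_w2 /bil_s /bil_r expr0; field; do ?[apply/andP; split].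
have Q_gtq : q < Q by apply: le_lt_trans Q_gt; rewrite -[leLHS]expr1 ler_eXn2l.
have P_gtq : q < P by apply: lt_le_trans P_ge.
by rewrite !mulf_neq0 ?invr_eq0 ?expf_neq0 ?mulf_neq0 // subr_eq0 gt_eqF.
Qed.

(** [radial_sum] gives the shape; the scalar is read off at [u = y], where [bil_w1_sqr] reduces the
    sum to n [bil_z0] because [bil_w1] and [bil_w2] sum to 0. *)
Lemma bil_kernel_sqr y u :
  \sum_z bil_w1 (D y z) * bil_w1 (D z u) = n * (q - 1) / (Q * P)
    * bil_w1 (D y u).
Proof.
have [p Hp] := radial_sum D_sym D_eq0 bil_c0 bil_cS_neq0 nbr_sum bil_w1_eig bil_w1.
rewrite Hp; congr (_ * _); apply: (mulIf bil_w10_neq0).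
rewrite -{1}(D_refl y) -Hp.
transitivity (\sum_z bil_w2 (D y z)
    + (2 * bil_h - bil_r) * \sum_z bil_w1 (D y z) + \sum_(z : T) bil_z0).
  rewrite mulr_sumr -!big_split; apply: eq_bigr => z _ /=.
  by rewrite [D z y]D_sym -bil_w1_sqr.
rewrite sum_bil_w1 sum_bil_w2 mulr0 !add0r sumr_const.
rewrite -mulr_natl -/n /bil_z0 /bil_w1 /bil_h expr0.
by field; apply/andP.
Qed.

Lemma bil_sphere_sum y (g : nat -> R) i s :
  \sum_(z | D y z == i) 1 = s -> \sum_(z | D y z == i) g (D y z) = s * g i.
Proof.
move=> <-; rewrite mulr_suml; apply: eq_bigr => z /eqP ->.
by rewrite mul1r.
Qed.

Definition bil_phi i : R :=
  (i == 2%N)%:R - bil_alpha * (i == 0%N)%:R - bil_beta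
    * (i == 1%N)%:R - bil_g / n.

Lemma sum_bil_phi y (F : T -> R) :
  \sum_z bil_phi (D y z) * F z =
    \sum_(z | D y z == 2%N) F z - bil_alpha * F y
    - bil_beta * (\sum_(z | D y z == 1%N) F z) - bil_g / n * \sum_z F z.
Proof.
have -> : F y = \sum_z (D y z == 0%N)%:R * F z.
  by rewrite sum_indicator (big_pred1 y) // => z; rewrite D_eq0 eq_sym.
rewrite -(sum_indicator F (fun z => D y z == 1%N)).
rewrite -(sum_indicator F (fun z => D y z == 2%N)) !mulr_sumr -!sumrB.
by apply: eq_bigr => z _; rewrite /bil_phi; ring.
Qed.

(** This is the hypothesis of [triple_product_eq0]. The function [bil_phi] is orthogonal to 1,
    [bil_w1] and [bil_w2] about [y]; [radial_orthogonal] extends this to every [u], and [bil_w1_sqr]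
    expands the square. *)
Lemma bil_phi_orth y u : n != 0 ->
  \sum_z bil_phi (D y z) * bil_w1 (D z u) ^+ 2 = 0.
Proof.
move=> n_neq0.
have k2 : \sum_(z | D y z == 2%N) 1 = bil_k2.
  apply: (mulfI (bil_cS_neq0 1)).
  rewrite (sphere2_card D_sym D_eq0 bil_c0 nbr_sum y bil_c1 erefl).
  by rewrite /bil_k2; field; apply: bil_cS_neq0.
have k1 := degree nbr_sum y.
have phi_g (g : nat -> R) : \sum_z bil_phi (D y z) * g (D y z) =
    bil_k2 * g 2%N - bil_alpha * g 0%N - bil_beta * (bil_b 0 * g 1%N)
    - bil_g / n * \sum_z g (D y z).
  by rewrite sum_bil_phi D_refl (bil_sphere_sum g k1) (bil_sphere_sum g k2).
have orth1 : \sum_z bil_phi (D y z) * bil_w1 (D y z) = 0.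
  by rewrite phi_g sum_bil_w1 mulr0 subr0 mulrA bil_alpha_w1.
have orth2 : \sum_z bil_phi (D y z) * bil_w2 (D y z) = 0.
  by rewrite phi_g sum_bil_w2 mulr0 subr0 mulrA bil_alpha_w2.
have orth0 : \sum_z bil_phi (D y z) = 0.
  under eq_bigr do rewrite -[bil_phi _]mulr1.
  rewrite (phi_g (fun=> 1)) sumr_const -mulr_natl -/n /bil_alpha.
  by field.
have orth := radial_orthogonal D_sym D_eq0 bil_c0 bil_cS_neq0 nbr_sum.
transitivity (\sum_z bil_phi (D y z) * bil_w2 (D z u)
    + (2 * bil_h - bil_r) * (\sum_z bil_phi (D y z) * bil_w1 (D z u))
    + bil_z0 * \sum_z bil_phi (D y z)).
  rewrite !mulr_sumr -!big_split; apply: eq_bigr => z _ /=.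
  by rewrite bil_w1_sqr; ring.
rewrite orth0 (orth _ _ bil_w1_eig bil_w10_neq0 bil_phi y orth1).
by rewrite (orth _ _ bil_w2_eig bil_w20_neq0 bil_phi y orth2) !mulr0 !addr0.
Qed.

(** * A local eigenvector and its images on the sphere of radius 2 *)

Variables (x : T) (v : T -> R) (eta : R).
Hypothesis v_supp : forall z, D x z != 1%N -> v z = 0.
Hypothesis v_sum : \sum_z v z = 0.
Hypothesis v_eig : forall y, D x y = 1%N -> nbr_op D v y = eta * v y.

Let N := \sum_z v z ^+ 2.
Let mu := bil_b 0 + (bil_b 0 - bil_b 1 - 1) * eta + bil_c 2 * (- 1 - eta).

Lemma local_shell0 y (F : T -> R) : \sum_(z | D y z == 0%N) F z = F y.
Proof. by rewrite (big_pred1 y) // => z; rewrite D_eq0 eq_sym. Qed.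

Lemma local_ball2 y z : D x y = 1%N -> (2 < D y z)%N -> v z = 0.
Proof.
move=> xy1 yz; apply: v_supp; apply: contraTN yz => /eqP xz1; rewrite -leqNgt.
by rewrite (leq_trans (dist_nbr_le nbr_sum y xz1)) // D_sym xy1.
Qed.

(** Neighbours of [x] are at distance at most 2 from each other, so the shells of radius 0, 1, 2
    about [y] exhaust the support of [v], whose total sum is 0. *)
Lemma local_shell2 y : D x y = 1%N ->
  \sum_(z | D y z == 2%N) v z = (- 1 - eta) * v y.
Proof.
move=> xy1; have := sum_ball2 D_eq0 (fun z => local_ball2 xy1 (z := z)).
rewrite v_sum -/(nbr_op D v y) v_eig // => E.
by apply: (addrI (v y + eta * v y)); rewrite -E; ring.
Qed.

Lemma local_kernel y : D x y = 1%N ->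
  kernel_op D bil_w1 v y = bil_lambda eta * v y.
Proof.
move=> xy1; rewrite /kernel_op (sum_ball2 D_eq0 (y := y)) => [|z yz];
  last first.
  by rewrite (local_ball2 xy1 yz) mulr0.
have shell i : \sum_(z | D y z == i) bil_w1 (D y z) * v z
    = bil_w1 i * \sum_(z | D y z == i) v z.
  by rewrite mulr_sumr; apply: eq_bigr => z /eqP ->.
rewrite !shell local_shell2 // -/(nbr_op D v y) v_eig // D_refl bil_lambdaE.
by ring.
Qed.

(** A^2 = c_2 A_2 + a_1 A + b_0 I, evaluated on the three shell sums of [v], yields [mu]. *)
Lemma local_nbr_nbr y : D x y = 1%N -> nbr_op D (nbr_op D v) y = mu * v y.
Proof.
move=> xy1; rewrite /nbr_op (sphere_sum_rec D_sym bil_c0 nbr_sum).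
rewrite local_shell2 // -/(nbr_op D v y) v_eig // local_shell0 bil_c1 /mu.
by ring.
Qed.

Lemma local_dot f kappa : (forall y, D x y = 1%N -> f y = kappa * v y) ->
  \sum_y f y * v y = kappa * N.
Proof.
move=> Hf; rewrite /N mulr_sumr; apply: eq_bigr => y _.
have [/eqP xy1|/v_supp ->] := boolP (D x y == 1%N); last by ring.
by rewrite Hf //; ring.
Qed.

Lemma local_sphere1 f g kappa lambda :
  (forall y, D x y = 1%N -> f y = kappa * v y) ->
  (forall y, D x y = 1%N -> g y = lambda * v y) ->
  \sum_(y | D x y == 1%N) f y * g y = kappa * lambda * N.
Proof.
move=> Hf Hg; rewrite /N mulr_sumr [LHS]big_mkcond; apply: eq_bigr => y _.
have [/eqP xy1|/v_supp ->] := boolP (D x y == 1%N); last by ring.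
by rewrite Hf // Hg //; ring.
Qed.

Let Av := nbr_op D v.
Let e := kernel_op D bil_w1 v.

Lemma nbr_x0 : Av x = 0.
Proof.
rewrite -v_sum /Av /nbr_op big_mkcond; apply: eq_bigr => z _.
by case: ifP => // /negbT/v_supp ->.
Qed.

Lemma kernel_x0 : e x = 0.
Proof.
rewrite /e /kernel_op; transitivity (bil_w1 1 * \sum_z v z);
  last by rewrite v_sum mulr0.
rewrite mulr_sumr; apply: eq_bigr => z _.
by have [/eqP -> //|/v_supp ->] := boolP (D x z == 1%N); rewrite !mulr0.
Qed.

Lemma nbr_far z : (2 < D x z)%N -> Av z = 0.
Proof.
move=> xz; rewrite /Av /nbr_op big1 // => y /eqP zy1; apply: v_supp.
apply: contraTN xz => /eqP xy1; rewrite -leqNgt -xy1.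
by rewrite (dist_nbr_le nbr_sum) // D_sym.
Qed.

(** The total |A v|^2 is <A^2 v, v> = [mu * N]. Since [Av] vanishes at [x] and beyond distance 2,
    only the share [eta ^+ 2 * N] of the neighbours of [x] is removed. *)
Lemma sphere2_nbr : \sum_(z | D x z == 2%N) Av z * Av z = (mu - eta ^+ 2) * N.
Proof.
have := sum_ball2 D_eq0 (y := x) (F := fun z => Av z * Av z).
rewrite nbr_x0 (local_sphere1 v_eig v_eig) (nbr_op_adjoint D_sym).
rewrite (local_dot local_nbr_nbr) => E.
transitivity (mu * N - eta * eta * N); last by ring.
by rewrite E => [|z /nbr_far ->]; [ring | rewrite mul0r].
Qed.

Lemma sphere2_kernel_nbr :
  \sum_(z | D x z == 2%N) e z * Av z =
    (bil_b 0 - Q * P / q - eta) * bil_lambda eta * N.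
Proof.
have := sum_ball2 D_eq0 (y := x) (F := fun z => e z * Av z).
rewrite nbr_x0 (local_sphere1 local_kernel v_eig) (nbr_op_adjoint D_sym).
rewrite (local_dot (kappa := (bil_b 0 - Q * P / q) * bil_lambda eta))
  => [E|y xy1]; last first.
  by rewrite (nbr_kernel_op D_sym nbr_sum _ _ bil_w1_eig) local_kernel // mulrA.
transitivity ((bil_b 0 - Q * P / q) * bil_lambda eta * N - bil_lambda eta
  * eta * N); last by ring.
by rewrite E => [|z /nbr_far ->]; [ring | rewrite mulr0].
Qed.

Lemma kernel_norm : \sum_z e z ^+ 2 = n * (q - 1) / (Q * P) * bil_lambda eta
  * N.
Proof.
under eq_bigr do rewrite expr2.
rewrite (kernel_op_adjoint D_sym) (local_dot (kappa
  := n * (q - 1) / (Q * P) * bil_lambda eta)) //.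
move=> y xy1; rewrite (kernel_kernel_op v y bil_kernel_sqr) local_kernel //.
by rewrite mulrA.
Qed.

(** Apply [triple_product_eq0] to [bil_phi] about [x]: the [bil_alpha] term drops out as [e x = 0],
    the [bil_beta] term is known from [local_kernel], and the constant term from [kernel_norm]. *)
Lemma sphere2_kernel : n != 0 ->
  \sum_(z | D x z == 2%N) e z * e z =
  (bil_beta * bil_lambda eta + Q * P * (q - 1) / q ^+ 4) * bil_lambda eta * N.
Proof.
move=> n_neq0.
have := triple_product_eq0 D_sym D_eq0 bil_c0 bil_cS_neq0 nbr_sum bil_w1_eig
  (phi := fun z => bil_phi (D x z)) v (fun u => bil_phi_orth x u n_neq0).
rewrite sum_bil_phi -/e kernel_x0 kernel_norm.
rewrite (local_sphere1 local_kernel local_kernel).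
set S := \sum_(z | _) _ => E.
have -> : S = bil_beta * (bil_lambda eta * bil_lambda eta * N) + bil_g / n *
  (n * (q - 1) / (Q * P) * bil_lambda eta * N).
  by apply/eqP; rewrite -subr_eq0 -E; apply/eqP; ring.
by rewrite /bil_g; field; do ?[apply/andP; split].
Qed.

Lemma local_eigenvalue_bounds : (exists z, v z != 0) ->
  (- q - 1 <= eta <= -1) \/ (Q - q - 1 <= eta <= P - q - 1).
Proof.
case=> z0 vz0; have n_gt0 : 0 < n by rewrite ltr0n; apply/card_gt0P; exists x.
have n_neq0 := lt0r_neq0 n_gt0.
have N_gt0 : 0 < N.
  rewrite lt_def sumr_ge0 ?andbT => [|z _]; last exact: sqr_ge0.
  rewrite psumr_neq0 => [|z _]; last exact: sqr_ge0.
  by apply/hasP; exists z0;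
    rewrite ?mem_index_enum // lt_def sqr_ge0 sqrf_eq0 vz0.
have lam_ge0 : 0 <= bil_lambda eta.
  have : 0 <= \sum_z e z ^+ 2 by apply: sumr_ge0 => z _; apply: sqr_ge0.
  rewrite kernel_norm pmulr_lge0 // pmulr_rge0 //
    divr_gt0 ?mulr_gt0 ?subr_gt0 //.
    exact: lt_trans ltr01 Q_gt1.
  exact: lt_trans ltr01 P_gt1.
move: lam_ge0; rewrite le_eqVlt => /orP[|lam_gt0].
  rewrite eq_sym mulf_eq0 mulf_eq0 invr_eq0 expf_eq0 (negPf q1_neq0)
    (negPf q_neq0) /=.
  by move/eqP=> eta_q; left; have := q_gt0; lra.
apply: cubic_bounds => //.
have := sum_Cauchy_Schwarz (fun z => D x z == 2%N) e Av.
rewrite sphere2_kernel // sphere2_nbr sphere2_kernel_nbr.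
move=> CS.
(* Both sides of Cauchy-Schwarz share the factor [bil_lambda eta * (N * N)], positive in this
   case. *)
rewrite -(ler_pM2r (mulr_gt0 lam_gt0 (mulr_gt0 N_gt0 N_gt0))).
by move: CS; rewrite -/mu; congr (_ <= _); ring.
Qed.

End BilinearArray.

(** * Distance in a connected graph *)

Section Distance.
Variables (T : finType) (adj : rel T).
Local Notation dist := (dist adj).
Local Notation walk := (walk_of_length adj).

Lemma walkP n x y :
  reflect (exists p, [/\ size p = n, path adj x p & last x p = y]) (walk n x y).
Proof.
apply: (iffP existsP)
  => [[p /andP[p_path /eqP p_last]]|[p [p_size p_path p_last]]].
  by exists p; rewrite size_tuple.
have p_size' : size p == n by apply/eqP.
by exists (Tuple p_size') => /=; rewrite p_path p_last eqxx.
Qed.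

(** Any walk shortens to one without repeated vertices, of length below [#|T|]; so the search
    defining [dist] succeeds and returns the minimum. *)
Lemma walk_dist n x y : walk n x y -> walk (dist x y) x y /\ (dist x y <= n)%N.
Proof.
case/walkP=> p [p_size p_path p_last].
case: (shortenP p_path) p_last => p' p'_path p'_uniq p'_sub p'_last.
have p'_lt : size p' < #|T| by rewrite -[(size p').+1]/(size
  (x :: p')) -(card_uniqP p'_uniq) max_card.
have p'_walk : walk (size p') x y by apply/walkP; exists p'.
have has_walk : has (fun m => walk m x y) (iota 0 #|T|).
  by apply/hasP; exists (size p'); rewrite ?mem_iota.
split.
  by have := nth_find 0 has_walk;
    rewrite nth_iota // -[X in _ < X](size_iota 0) -has_find.
have p'_le : size p' <= n.
  by case/andP: p'_uniq => _ p'_uniq; rewrite -p_size uniq_leq_size.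
apply: leq_trans p'_le; rewrite leqNgt; apply/negP => /(before_find 0).
by rewrite nth_iota // p'_walk.
Qed.

Lemma dist_eqP m x y :
  walk m x y -> (forall n, walk n x y -> (m <= n)%N) -> dist x y = m.
Proof.
move=> m_walk m_min; have [dist_walk dist_le] := walk_dist m_walk.
by apply/eqP; rewrite eqn_leq dist_le m_min.
Qed.

Lemma dist_le_diameter x y : dist x y <= diameter adj.
Proof.
apply: leq_trans (leq_bigmax x); exact: (leq_bigmax (F := fun y => dist x y)).
Qed.

Hypotheses (adj_simple : simple_graph adj) (adj_conn : connected_graph adj).

Lemma dist_walk x y : walk (dist x y) x y.
Proof.
have /connectP[p p_path p_last] := adj_conn x y.
have p_walk : walk (size p) x y by apply/walkP; exists p.
by case: (walk_dist p_walk).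
Qed.

Lemma walk_sym n x y : walk n x y = walk n y x.
Proof.
suff sub u v : walk n u v -> walk n v u by apply/idP/idP; apply: sub.
case/walkP=> p [p_size p_path p_last]; apply/walkP.
exists (rev (belast u p)); rewrite size_rev size_belast p_size; split=> //.
  by rewrite -p_last rev_path (eq_path (e' := adj)) // => a b;
    rewrite adj_simple.1.
by case: p {p_size} p_last p_path => [<- //|a p _ _] /=;
  rewrite rev_cons last_rcons.
Qed.

Lemma dist_sym x y : dist x y = dist y x.
Proof. by apply: eq_find => n; apply: walk_sym. Qed.

Lemma dist_eq0 x y : (dist x y == 0) = (x == y).
Proof.
apply/eqP/eqP => [xy0|->].
  by have := dist_walk x y; rewrite xy0 => /walkP[p [/size0nil -> _]].
by apply: dist_eqP => //; apply/walkP; exists [::].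
Qed.

Lemma dist_eq1 x y : (dist x y == 1) = adj x y.
Proof.
apply/eqP/idP => [xy1|xy].
  have := dist_walk x y; rewrite xy1 => /walkP[[|z [|? ?]] [//= _]].
  by rewrite andbT => + <-.
apply: dist_eqP => [|[/walkP[p [/size0nil -> _ /= xy_eq]]|//]].
  by apply/walkP; exists [:: y] => /=; rewrite xy.
by move: xy; rewrite xy_eq adj_simple.2.
Qed.

Lemma dist_adj_le u y z : adj y z -> dist u z <= (dist u y).+1.
Proof.
move=> yz; have /walkP[p [p_size p_path p_last]] := dist_walk u y.
have z_walk : walk (dist u y).+1 u z.
  apply/walkP; exists (rcons p z);
    rewrite size_rcons p_size rcons_path last_rcons.
  by rewrite p_last p_path.
by case: (walk_dist z_walk).
Qed.

Lemma c_num0 x y : dist x y = 0 -> c_num adj x y = 0.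
Proof.
move=> xy0; apply/eqP; rewrite cards_eq0; apply/eqP/setP => z.
by rewrite !inE xy0 andbF.
Qed.

Lemma b_num_diameter x y : dist x y = diameter adj -> b_num adj x y = 0.
Proof.
move=> xyD; apply/eqP; rewrite cards_eq0; apply/eqP/setP => z.
rewrite !inE xyD; case: eqP => //= _; apply/negbTE/negP => /eqP xz.
by have := dist_le_diameter x z; rewrite xz ltnn.
Qed.

Lemma natr_nbr_card (R : realFieldType) y (P : pred T) :
  (#|sphere adj 1 y :&: [set z | P z]|%:R =
    \sum_(z | dist y z == 1%N) (P z)%:R :> R)%R.
Proof.
rewrite -sum1_card natr_sum big_mkcond [RHS]big_mkcond; apply: eq_bigr => z _.
by rewrite !inE; case: (dist y z == 1%N) => //=; case: (P z).
Qed.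

(** By the triangle inequality every neighbour of [y] is counted by c, a or b. The valency is
    written [b_num adj y y], since b_0 counts all neighbours. *)
Lemma graph_nbr_sum (R : realFieldType) (g : nat -> R) u y :
  (\sum_(z | dist y z == 1%N) g (dist u z) =
    (c_num adj u y)%:R * g (dist u y).-1
    + ((b_num adj y y)%:R - (b_num adj u y)%:R - (c_num adj u y)%:R)
      * g (dist u y)
    + (b_num adj u y)%:R * g (dist u y).+1)%R.
Proof.
rewrite /c_num /b_num /sphere !natr_nbr_card -!sumrB !mulr_suml -!big_split.
apply: eq_bigr => z yz1; rewrite dist_eq1 in yz1 => /=.
have uz := dist_adj_le u yz1.
have zy : adj z y by rewrite adj_simple.1.
have uy := dist_adj_le u zy.
have yy : dist y y = 0%N by apply/eqP; rewrite dist_eq0.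
rewrite yy [(dist y z == 1%N)]dist_eq1 yz1.
move: uz uy; case: (ltngtP (dist u z) (dist u y)) => [lt _ le|lt le _|-> _ _].
- have -> : dist u y = (dist u z).+1 by apply/eqP; rewrite eqn_leq le lt.
  have -> : (dist u z == (dist u z).+2) = false by rewrite ltn_eqF.
  by rewrite eqxx /=; ring.
- have -> : dist u z = (dist u y).+1 by apply/eqP; rewrite eqn_leq le lt.
  have -> : ((dist u y).+2 == dist u y) = false by rewrite gtn_eqF.
  by rewrite eqxx /=; ring.
have -> : (dist u y == (dist u y).+1) = false by rewrite ltn_eqF.
have -> : ((dist u y).+1 == dist u y) = false by rewrite gtn_eqF.
by rewrite /=; ring.
Qed.

End Distance.

(** * Intersection numbers of the bilinear forms graph *)

Section RankOne.
Local Open Scope ring_scope.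
Variables (F : fieldType) (d e : nat).
Implicit Types (X N : 'M[F]_(d, e)) (a : 'rV[F]_d) (b : 'rV[F]_e).

Lemma outer_entry a b i j : (a^T *m b) i j = a 0 i * b 0 j.
Proof. by rewrite mxE big_ord1 mxE. Qed.

Lemma outer_eq0 a b : (a^T *m b == 0) = (a == 0) || (b == 0).
Proof.
apply/idP/idP => [|/orP[] /eqP->]; last by rewrite mulmx0.
  apply: contraTT; rewrite negb_or => /andP[/rV0Pn[i ai] /rV0Pn[j bj]].
  apply: contraNneq (mulf_neq0 ai bj) => ab0.
  by rewrite -outer_entry ab0 mxE.
by rewrite trmx0 mul0mx.
Qed.

Lemma rank_outer a b : a != 0 -> b != 0 -> \rank (a^T *m b)%R = 1%N.
Proof.
move=> a0 b0; apply/eqP; rewrite eqn_leq mulmx_max_rank lt0n mxrank_eq0.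
by rewrite outer_eq0 negb_or a0.
Qed.

Lemma rank1_outer N : \rank N = 1%N ->
  exists a b, [/\ a != 0, b != 0 & N = a^T *m b].
Proof.
move=> rN; have : N != 0 by rewrite -mxrank_eq0 rN.
move: (col_base N) (row_base N) (mulmx_base N); rewrite rN => a b <-.
rewrite -[a]trmxK outer_eq0 negb_or => /andP[a0 b0].
by exists a^T, b.
Qed.

Lemma outer_inj a b a0 b0 : a0 != 0 -> b0 != 0 -> a^T *m b = a0^T *m b0 ->
  exists l, [/\ l != 0, a = l *: a0 & b = l^-1 *: b0].
Proof.
move=> /rV0Pn[i ai] /rV0Pn[j bj] /matrixP E.
have Eij i' j' : a 0 i' * b 0 j' = a0 0 i' * b0 0 j' by rewrite -!outer_entry.
have : a 0 i * b 0 j != 0 by rewrite Eij mulf_neq0.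
rewrite mulf_eq0 negb_or => /andP[ai' bj'].
exists (b0 0 j / b 0 j); split.
- by rewrite mulf_neq0 ?invr_eq0.
- by apply/rowP => i'; rewrite mxE; apply: (mulIf bj'); rewrite Eij; field.
apply/rowP => j'; rewrite mxE invf_div; apply: (mulfI ai'); rewrite Eij.
rewrite mulrA mulrA Eij; field.
by [].
Qed.

Lemma rank_add_outer X N : \rank N = 1%N -> (\rank (X + N)%R <= (\rank X).+1)%N.
Proof. by move=> rN; rewrite -addn1 -rN mxrank_add. Qed.

(** If [a] is in the column space or [b] in the row space, that space does not grow. Otherwise some
    [u] kills [X] and has [u *m a^T = 1], so [u] maps the sum to [b]; its row space contains [b] and
    [X], hence is strictly larger. *)
Lemma rank_outer_incr X a b :
  (\rank (X + a^T *m b)%R == (\rank X).+1) =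
    ~~ (a <= X^T)%MS && ~~ (b <= X)%MS.
Proof.
have le_row m n (Y : 'M[F]_(m, n)) (u : 'rV_m) (v : 'rV_n) :
    (v <= Y)%MS -> (\rank (Y + u^T *m v)%R <= \rank Y)%N.
  by move=> vY; apply: mxrankS; rewrite addmx_sub // mulmx_sub.
have [aX|aX] /= := boolP (a <= X^T)%MS.
  apply/negbTE; rewrite neq_ltn ltnS -mxrank_tr linearD /= trmx_mul trmxK.
  by rewrite -(mxrank_tr X) le_row.
have [bX|bX] := boolP (b <= X)%MS.
  by apply/negbTE; rewrite neq_ltn ltnS le_row.
have [u [uX ua]] : exists u : 'rV_d, u *m X = 0 /\ u *m a^T = 1%:M.
  move: aX; rewrite submxE => /rV0Pn[i]; set c := cokermx (X^T).
  move=> aci; exists (((a *m c) 0 i)^-1 *: (col i c)^T).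
  rewrite -!scalemxAl; split.
    rewrite -[X]trmxK -trmx_mul;
      rewrite (_ : X^T *m col i c = 0) ?trmx0 ?scaler0 //.
    by rewrite colE mulmxA mulmx_coker mul0mx.
  rewrite -trmx_mul (_ : a *m col i c = col i (a *m c));
    last by rewrite !colE mulmxA.
  set s := (a *m c) 0 i in aci *.
  by apply/matrixP => p r; rewrite !ord1 mxE mxE mxE -/s mulVf // mxE.
have bXN : (b <= (X + a^T *m b)%R)%MS.
  by apply/submxP; exists u; rewrite mulmxDr uX add0r mulmxA ua mul1mx.
have XXN : (X <= (X + a^T *m b)%R)%MS.
  by rewrite -{1}(addrK (a^T *m b) X) addmx_sub // eqmx_opp mulmx_sub.
have b0 : b != 0 by apply: contraNneq bX => ->; apply: sub0mx.
have a0 : a != 0 by apply: contraNneq aX => ->; apply: sub0mx.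
rewrite eqn_leq rank_add_outer ?rank_outer //=.
by apply: rank_ltmx; rewrite /ltmx XXN; apply: contra bX => /(submx_trans bXN).
Qed.

(** Wedderburn's rank reduction: for a nonzero entry [X i j], subtract column j times row i divided
    by that entry. The row space does not grow and column j becomes zero, so the rank drops. *)
Lemma rank_decr X r : \rank X = r.+1 ->
  exists2 N, \rank N = 1%N & \rank (X - N)%R = r.
Proof.
move=> rX; have X0 : X != 0 by rewrite -mxrank_eq0 rX.
have [i [j Xij]] : exists i j, X i j != 0.
  exact/matrix0Pn.
pose N := ((col j X)^T)^T *m ((X i j)^-1 *: row i X).
have N_outer : \rank N = 1%N.
  apply: rank_outer.
    by apply/rV0Pn; exists i; rewrite !mxE.
  by apply/rV0Pn; exists j; rewrite !mxE mulVf ?oner_eq0.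
exists N => //; apply/eqP; rewrite eqn_leq -ltnS -rX; apply/andP; split.
  apply: rank_ltmx; rewrite /ltmx addmx_sub ?eqmx_opp ?mulmx_sub ?scalemx_sub ?row_sub //=.
  apply/negP => /submxP[Y XY].
  have : col j X != 0.
    by apply: contraNneq Xij => /matrixP/(_ i 0); rewrite !mxE => ->.
  rewrite {1}XY colE -mulmxA -colE (_ : col j (X - N) = 0) ?mulmx0 ?eqxx //.
  apply/colP => p; rewrite !mxE big_ord1 !mxE mulVf // mulr1; ring.
by rewrite -ltnS -rX -{1}(subrK N X) rank_add_outer.
Qed.

End RankOne.

(** * Rank distance and counting of neighbours *)

Section BilinearForms.
Local Open Scope ring_scope.
Variables (F : finFieldType) (d e : nat).
Local Notation bil := (bilinear_forms_graph F d e).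
Implicit Types (X Y N : 'M[F]_(d, e)).

Lemma bil_simple : simple_graph bil.
Proof.
split=> [X Y|X]; rewrite /bilinear_forms_graph.
  by rewrite -(mxrank_opp (X - Y)) opprB.
by rewrite subrr mxrank0.
Qed.

Lemma bil_walk_rank n X Y : walk_of_length bil n X Y -> (\rank
  (X - Y)%R <= n)%N.
Proof.
case/walkP=> p [<- + <-] {Y}; elim: p X => [|Z p IH] X /=.
  by rewrite subrr mxrank0.
case/andP=> /eqP XZ /IH le_p; rewrite -(subrK Z X) -addrA -add1n -XZ.
by apply: leq_trans (mxrank_add _ _) _; rewrite leq_add2l.
Qed.

Lemma bil_rank_walk X Y : walk_of_length bil (\rank (X - Y)%R) X Y.
Proof.
move: {2}(\rank _) (erefl (\rank (X - Y)%R)) => r; elim: r X => [|r IH] X rXY.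
  have /eqP := rXY; rewrite mxrank_eq0 subr_eq0 => /eqP ->.
  by rewrite subrr mxrank0; apply/walkP; exists [::].
have [N N1 Nr] := rank_decr rXY; rewrite rXY.
have XNY : \rank (X - N - Y)%R = r by rewrite addrAC.
have /walkP[p [p_size p_path p_last]] := IH _ XNY.
apply/walkP; exists ((X - N) :: p); rewrite /= p_size XNY p_path andbT.
by split=> //; rewrite /bilinear_forms_graph subKr N1.
Qed.

Lemma bil_dist X Y : dist bil X Y = \rank (X - Y)%R.
Proof. by apply: dist_eqP (bil_rank_walk X Y) _ => n; apply: bil_walk_rank. Qed.

Lemma bil_connected : connected_graph bil.
Proof.
move=> X Y; have /walkP[p [_ p_path p_last]] := bil_rank_walk X Y.
by apply/connectP; exists p.
Qed.

Lemma bil_diameter : (diameter bil <= d)%N.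
Proof.
by apply/bigmax_leqP => X _; apply/bigmax_leqP => Y _;
  rewrite bil_dist rank_leq_row.
Qed.

Variable R : realFieldType.
Local Notation q := (#|F|%:R : R).
Local Notation Q := (q ^+ d).
Local Notation P := (q ^+ e).

Let q_gt1 : 1 < q. Proof. by rewrite ltr1n card_finNzRing_gt1. Qed.
Let q_neq0 : q != 0. Proof. by rewrite gt_eqF // (lt_trans ltr01). Qed.
Let q1_neq0 : q - 1 != 0. Proof. by rewrite subr_eq0 gt_eqF. Qed.

Lemma sum_predC (I : finType) (B : pred I) :
  \sum_i (~~ B i)%:R = #|I|%:R - \sum_i (B i)%:R :> R.
Proof.
rewrite -sum1_card natr_sum -sumrB; apply: eq_bigr => i _.
by case: (B i); rewrite ?subrr ?subr0.
Qed.

Lemma card_row n : #|{: 'rV[F]_n}|%:R = q ^+ n.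
Proof. by rewrite card_mx mul1n natrX. Qed.

Lemma sum_row_space n m (A : 'M[F]_(m, n)) :
  \sum_(u : 'rV[F]_n) (u <= A)%MS%:R = q ^+ \rank A.
Proof.
rewrite -natrX -card_rowg -sum1_card natr_sum [RHS]big_mkcond.
by apply: eq_bigr => u _; rewrite inE; case: (u <= A)%MS.
Qed.

Lemma sum_left_kernel n m (A : 'M[F]_(m, n)) :
  \sum_(u : 'rV[F]_m) (u *m A == 0)%:R = q ^+ m / q ^+ \rank A.
Proof.
rewrite -expfB_cond ?(negPf q_neq0) ?rank_leq_row // -mxrank_ker -sum_row_space.
by apply: eq_bigr => u _; rewrite (sameP sub_kermxP eqP).
Qed.

(** By [outer_inj] the factorizations of a rank 1 matrix are the pairs [(l *: a0, l^-1 *: b0)] with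
    [l] nonzero, q - 1 in number. *)
Lemma outer_sum (h : 'M[F]_(d, e) -> R) :
  \sum_(a : 'rV[F]_d | a != 0) \sum_(b : 'rV[F]_e | b != 0) h (a^T *m b) =
  (q - 1) * \sum_(N | \rank N == 1%N) h N.
Proof.
rewrite pair_big (partition_big (fun ab => ab.1^T *m ab.2)
  (fun N => \rank N == 1%N)) /=.
  rewrite mulr_sumr; apply: eq_bigr => N /eqP/rank1_outer[a0 [b0 [a0_neq0 b0_neq0 N_eq]]].
  under eq_bigr => ab /andP[_ /eqP ->] do rewrite -[h N]mul1r.
  rewrite -mulr_suml; congr (_ * _).
  transitivity (#|[set
    (l *: a0, l^-1 *: b0) | l in [set l : F | l != 0]]|%:R : R).
    rewrite -sum1_card natr_sum; apply: eq_bigl => -[a b] /=.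
    apply/idP/imsetP => [/andP[_ /eqP ab]|[l]].
      have [l [l0 -> ->]] := outer_inj a0_neq0 b0_neq0 (etrans ab N_eq).
      by exists l; rewrite ?inE.
    rewrite inE => l0 [-> ->];
      rewrite !scaler_eq0 invr_eq0 (negPf l0) a0_neq0 b0_neq0 /=.
    by rewrite !linearZ /= -scalemxAl scalerA mulVf // scale1r N_eq.
  rewrite card_in_imset => [|l l' _ _ [/eqP]]; last first.
    by rewrite -subr_eq0 -scalerBl scaler_eq0
      (negPf a0_neq0) orbF subr_eq0 => /eqP.
  have -> : [set l : F | l != 0] = [set~ 0] by apply/setP => l; rewrite !inE.
  by rewrite cardsC1 -subn1 natrB // ltnW // card_finNzRing_gt1.
by case=> a b /andP[a0 b0]; rewrite /= rank_outer.
Qed.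

Lemma nbr_shift X (h : 'M[F]_(d, e) -> R) :
  \sum_(Y | \rank (X - Y)%R == 1%N) h Y = \sum_(N | \rank N == 1%N) h (X + N).
Proof.
rewrite (reindex_inj (addrI X)); apply: eq_bigl => N /=.
by rewrite opprD addNKr mxrank_opp.
Qed.

Lemma sum_row_neq0 n (f : 'rV[F]_n -> R) :
  \sum_(a | a != 0) f a = \sum_a f a - f 0.
Proof. by rewrite [in RHS](bigD1 0) //= addrAC subrr add0r. Qed.

Lemma sum_row1 n : \sum_(a : 'rV[F]_n) 1 = q ^+ n :> R.
Proof. by rewrite sumr_const card_row. Qed.

Lemma bil_dist0 X : dist bil 0 X = \rank X.
Proof. by rewrite bil_dist sub0r mxrank_opp. Qed.

Lemma sum_bil_nbr X (h : 'M[F]_(d, e) -> R) :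
  (q - 1) * \sum_(Y | dist bil X Y == 1%N) h Y =
  \sum_(a : 'rV[F]_d | a != 0) \sum_(b : 'rV[F]_e | b != 0) h (X + a^T *m b).
Proof.
rewrite (outer_sum (fun N => h (X + N))) -nbr_shift; congr (_ * _).
by apply: eq_bigl => Y; rewrite bil_dist.
Qed.

Lemma bil_degree X : (b_num bil X X)%:R = bil_b q Q P 0.
Proof.
have := graph_nbr_sum bil_simple bil_connected (fun=> 1 : R) X X.
rewrite !mulr1 addrC addrA [_ + (_ - _ - _)]addrA => deg.
apply: (mulfI q1_neq0);
  transitivity ((q - 1) * \sum_(Y | dist bil X Y == 1%N) 1).
  by rewrite deg; ring.
rewrite (sum_bil_nbr X (fun=> 1)); transitivity
  ((\sum_(a : 'rV[F]_d | a != 0) 1) * (\sum_(b : 'rV[F]_e | b != 0) 1) : R).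
  by rewrite mulr_suml; apply: eq_bigr => a _; rewrite mul1r.
by rewrite !sum_row_neq0 !sum_row1 /bil_b expr0; field.
Qed.

(** By [rank_outer_incr] the pairs to count are a product set: (Q - q^r)(P - q^r) of them for rank
    r. The zero vectors exclude themselves, as they lie in every subspace. *)
Lemma bil_b_num X : (b_num bil 0 X)%:R = bil_b q Q P (\rank X).
Proof.
apply: (mulfI q1_neq0);
  rewrite /b_num /sphere natr_nbr_card sum_bil_nbr bil_dist0.
have rank_incr (a : 'rV[F]_d) (b : 'rV[F]_e) : (dist bil 0 (X
  + a^T *m b) == (\rank X).+1)%:R
    = (~~ (a <= X^T)%MS)%:R * (~~ (b <= X)%MS)%:R :> R.
  by rewrite bil_dist0 rank_outer_incr -natrM mulnb.
transitivity ((\sum_(a : 'rV[F]_d) (~~ (a <= X^T)%MS)%:R) *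
    (\sum_(b : 'rV[F]_e) (~~ (b <= X)%MS)%:R) : R).
  rewrite sum_row_neq0 [X in _ - X]big1 => [|b _];
    last by rewrite rank_incr sub0mx mul0r.
  rewrite subr0 mulr_suml; apply: eq_bigr => a _.
  rewrite sum_row_neq0 rank_incr sub0mx mulr0 subr0 mulr_sumr.
  by apply: eq_bigr => b _; rewrite rank_incr.
rewrite !sum_predC !card_row !sum_row_space mxrank_tr /bil_b.
by field.
Qed.

Lemma sum_orthogonal (u : 'rV[F]_d) : u != 0 ->
  \sum_(a : 'rV[F]_d) ((u *m a^T) 0 0 == 0)%:R = Q / q.
Proof.
move=> u0; have := sum_left_kernel u^T;
  rewrite mxrank_tr rank_rV u0 expr1 => <-.
apply: eq_bigr => a _; congr (nat_of_bool _)%:R.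
rewrite -(inj_eq trmx_inj) trmx_mul trmxK trmx0.
by apply/eqP/eqP => [E|->]; [rewrite [LHS]mx11_scalar E raddf0 | rewrite mxE].
Qed.

(* Counting the pairs [(u, N)] with [N] of rank 1 and [u (X + N) = 0] by [u]. *)
Lemma sum_kernel_outer X (u : 'rV[F]_d) :
  \sum_(a : 'rV[F]_d | a != 0) \sum_(b : 'rV[F]_e | b != 0)
    (u *m (X + a^T *m b) == 0)%:R =
  (u == 0)%:R * ((Q - Q / q) * (P - 1))
  + (u *m X == 0)%:R * ((Q / q - 1) * (P - 1) - (Q - Q / q))
  + (Q - Q / q) :> R.
Proof.
have outerE (a : 'rV[F]_d) (b : 'rV[F]_e) : u *m (X + a^T *m b) = u *m X
  + (u *m a^T) 0 0 *: b.
  by rewrite mulmxDr mulmxA [in LHS](mx11_scalar (u *m a^T)) mul_scalar_mx.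
have [uX|uX] := eqVneq (u *m X) 0.
  pose f (a : 'rV[F]_d) : R := ((u *m a^T) 0 0 == 0)%:R.
  have f0 : f 0 = 1 by rewrite /f trmx0 mulmx0 mxE eqxx.
  transitivity ((P - 1) * (\sum_a f a - f 0)).
    rewrite -sum_row_neq0 mulr_sumr /f.
    apply: eq_bigr => a _.
    rewrite -sum_row1 -(sum_row_neq0 (fun=> 1)) mulr_suml;
      apply: eq_bigr => b b0.
    by rewrite outerE uX add0r scaler_eq0 (negPf b0) orbF mul1r.
  rewrite f0 /f; have [->|u0] := eqVneq u 0;
    last by rewrite sum_orthogonal //=; ring.
  under eq_bigr do rewrite mul0mx mxE eqxx.
  by rewrite sum_row1 /=; ring.
have u0 : u != 0 by apply: contraNneq uX => ->; rewrite mul0mx.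
rewrite (negPf u0) /= mul0r mul0r !add0r -(sum_orthogonal u0).
rewrite -[Q]card_row -sum_predC.
rewrite [RHS](bigD1 0) //= trmx0 mulmx0 mxE eqxx add0r; apply: eq_bigr => a _.
have [z0|z0] /= := eqVneq ((u *m a^T) 0 0) 0.
  by rewrite big1 // => b _; rewrite outerE z0 scale0r addr0 (negPf uX).
set z := (u *m a^T) 0 0 in z0 *.
(* The only [b] that solves u X + z b = 0; it is nonzero because u X is. *)
rewrite (bigD1 (- z^-1 *: (u *m X))) /=; last first.
  by rewrite scaler_eq0 oppr_eq0 invr_eq0 (negPf z0).
rewrite outerE -/z scalerA mulrN mulfV // scaleN1r subrr eqxx.
rewrite big1 ?addr0 // => b /andP[_ bz]; rewrite outerE -/z.
case: eqP => // /eqP; rewrite addrC addr_eq0 => /eqP zb; case/eqP: bz.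
by rewrite scaleNr -scalerN -zb scalerA mulVf // scale1r.
Qed.

(** Take g(i) = Q / q^i, the number of [u] with u Y = 0 for [Y] of rank i. Its sum over the
    neighbours of [X] is known from [sum_kernel_outer], and as b and the valency are known,
    [graph_nbr_sum] becomes a linear equation for c. *)
Lemma bil_c_num X : (c_num bil 0 X)%:R = bil_c q (\rank X).
Proof.
have [r0|] := posnP (\rank X).
  by rewrite c_num0 ?bil_dist0 // r0 /bil_c expr0 subrr mulr0 mul0r.
case r_eq : (\rank X) => [//|r] _.
have := graph_nbr_sum bil_simple bil_connected (fun i => Q / q ^+ i) 0 X.
rewrite bil_dist0 bil_b_num bil_degree r_eq /=.
move/(congr1 (fun z => (q - 1) * z)); rewrite sum_bil_nbr.
under eq_bigr do under eq_bigr do rewrite bil_dist0 -sum_left_kernel.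
under eq_bigr do rewrite exchange_big.
rewrite exchange_big /=; under eq_bigr do rewrite sum_kernel_outer.
rewrite !big_split /= -!mulr_suml sum_left_kernel !sumr_const r_eq.
have -> : \sum_(u : 'rV[F]_d) (u == 0)%:R = 1 :> R.
  rewrite (bigD1 0) //= eqxx big1 ?addr0 // => u /negPf -> //.
rewrite -mulrnDl -(mulr_natr (Q - Q / q)) card_row.
have y0 : q ^+ r != 0 by rewrite expf_neq0.
have Q0 : Q != 0 by rewrite expf_neq0.
move: (c_num _ _ _)%:R => c; rewrite /bil_b /bil_c /= expr0 !exprS.
set y := q ^+ r in y0 *; set lhs := (X in X = _ -> _) => E.
(* The coefficient of c in that equation, (q - 1)(g(r) - g(r + 1)). *)
have coef0 : (q - 1) ^+ 2 * Q / (q * y) != 0.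
  by rewrite !mulf_neq0 ?invr_eq0 ?mulf_neq0.
apply: (mulIf coef0).
transitivity (lhs - (q - 1) *
  (((Q - 1) * (P - 1) - (Q - q * y) * (P - q * y)) / (q - 1) * (Q / (q * y))
   + (Q - q * y) * (P - q * y) / (q - 1) * (Q / (q * (q * y))))).
  by rewrite E; field; do ?[apply/andP; split].
by rewrite /lhs; field; do ?[apply/andP; split].
Qed.

End BilinearForms.

(** * Transfer of the intersection numbers *)

Section SameArray.
Variables (F : finFieldType) (d e : nat) (T : finType) (adj : rel T).
Local Notation bil := (bilinear_forms_graph F d e).
Hypotheses (d_le_e : d <= e) (same : same_intersection_array adj bil).

(** A pair at distance i is compared with 0 and the partial identity matrix of rank i, which exists
    because i is at most the common diameter, hence at most d. *)
Lemma same_array_nums u y : exists X : 'M[F]_(d, e),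
  [/\ \rank X = dist adj u y, b_num adj u y = b_num bil 0%R X
    & c_num adj u y = c_num bil 0%R X].
Proof.
have [bs [cs [[bsT _ bT cT] [bsB _ bB cB]]]] := same.
have diamE : diameter adj = diameter bil by rewrite -bsT.
have i_le : dist adj u y <= diameter bil by rewrite -diamE dist_le_diameter.
have i_le_d := leq_trans i_le (bil_diameter F d e).
have rX : \rank (pid_mx (dist adj u y) : 'M[F]_(d, e)) = dist adj u y.
  by rewrite rank_pid_mx // (leq_trans i_le_d).
exists (pid_mx (dist adj u y)); split=> //.
  (* The array lists neither b at the diameter nor c at 0; both vanish in either graph. *)
  case: (ltngtP (dist adj u y) (diameter bil)) i_le => // [i_lt _|i_eq _].
    by rewrite bT ?diamE // bB bil_dist0 rX.
  by rewrite !b_num_diameter ?bil_dist0 ?rX ?diamE.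
have [i0|i_gt0] := posnP (dist adj u y).
  by rewrite !c_num0 ?bil_dist0 ?rX.
by rewrite cT // cB bil_dist0 rX.
Qed.

Lemma same_array_nbr_sum (R : realFieldType) (g : nat -> R) u y :
  simple_graph adj -> connected_graph adj ->
  let b := bil_b (#|F|%:R : R) (#|F|%:R ^+ d) (#|F|%:R ^+ e) in
  let c := bil_c (#|F|%:R : R) in
  (\sum_(z | dist adj y z == 1%N) g (dist adj u z) =
    c (dist adj u y) * g (dist adj u y).-1
    + (b 0 - b (dist adj u y) - c (dist adj u y)) * g (dist adj u y)
    + b (dist adj u y) * g (dist adj u y).+1)%R.
Proof.
move=> adj_simple adj_conn b c; rewrite graph_nbr_sum //.
have [X [rX -> ->]] := same_array_nums u y.
have [Y [rY -> _]] := same_array_nums y y.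
have yy : dist adj y y = 0 by apply/eqP; rewrite dist_eq0.
by rewrite !bil_b_num bil_c_num rX rY yy.
Qed.

End SameArray.

(** * Local eigenvectors as functions on the vertices *)

(** The row eigenvector lives on the subtype of [A] and is extended by 0; symmetry of [adj] turns
    the left eigenvector equation into a sum over neighbours. *)
Lemma nonprincipal_eigenfunction (R : fieldType) (T : finType) (adj : rel T)
    (A : {set T}) (eta : R) : symmetric adj ->
  nonprincipal_eigenvalue (induced adj (A := A)) eta ->
  exists v : T -> R,
    [/\ forall z, z \notin A -> v z = 0%R, (\sum_z v z = 0)%R,
        forall y, y \in A -> (\sum_(z | adj y z) v z = eta * v y)%R
      & exists z, v z != 0%R].
Proof.
move=> adj_sym [_ [f [f_neq0 /eigenspaceP f_eig f_sum]]].
pose V := {z : T | z \in A}.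
pose v z : R := if insub z is Some s then f 0%R (enum_rank (s : V)) else 0%R.
have v_val (s : V) : v (val s) = f 0%R (enum_rank s) by rewrite /v valK.
have v_out z : z \notin A -> v z = 0%R by move=> zA; rewrite /v insubN.
have sum_v (h : T -> R) : (\sum_z h z * v z =
    \sum_(i < #|{: V}|) h (val (enum_val i)) * f 0 i)%R.
  rewrite (bigID (mem A)) /= [X in (_ + X)%R]big1 => [|z /v_out->];
    last by rewrite mulr0.
  rewrite addr0 big_sub /= (reindex _ (onW_bij _ (enum_val_bij V))) /=.
  by apply: eq_bigr => i _; rewrite v_val enum_valK.
exists v; split=> //.
- have := sum_v (fun=> 1%R); rewrite (eq_bigr v) => [->|z _];
  last by rewrite mul1r.
  move/matrixP/(_ 0 0)%R: f_sum; rewrite !mxE => f_sum; rewrite -[RHS]f_sum.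
  by apply: eq_bigr => i _; rewrite mxE mulrC.
- move=> y yA; rewrite -(sum_indicator _ (adj y)) sum_v.
  move/matrixP/(_ 0 (enum_rank (Sub y yA : V)))%R: f_eig; rewrite !mxE.
  rewrite -v_val /= => <-; apply: eq_bigr => i _.
  by rewrite mxE enum_rankK /= adj_sym mulrC.
have /rV0Pn[i fi] := f_neq0.
by exists (val (enum_val i)); rewrite v_val enum_valK.
Qed.

Theorem proposition1p1 (R : rcfType) (q p k d e : nat) (F : finFieldType)
    (T : finType) (adj : rel T) (x : T) (eta : R)
    (hp : prime p) (hk : (0 < k)%N) (hq : q = (p ^ k)%N)
    (hF : #|F| = q)
    (hd : (3 <= d)%N) (hde : (d <= e)%N)
    (hdrg : distance_regular adj)
    (harr : same_intersection_array adj (bilinear_forms_graph F d e))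
    (heta : nonprincipal_eigenvalue (local_graph adj x) eta) :
  ((- q%:R - 1 <= eta <= -1) \/
   (q%:R ^+ d - q%:R - 1 <= eta <= q%:R ^+ e - q%:R - 1))%R.
Proof.
have [adj_simple adj_conn _] := hdrg.
have [v [v_out v_sum v_eig v_neq0]] :=
  nonprincipal_eigenfunction adj_simple.1 heta.
have q_gt1 : (1 < q%:R :> R)%R by rewrite ltr1n -hF card_finNzRing_gt1.
apply: (@local_eigenvalue_bounds _ _ _ _ _ _ _ T (dist adj) _ _ _ x v) => //.
(* Here [hd] enters, as q^2 < q^d. *)
- by rewrite ltr_eXn2l.
- by rewrite ler_eXn2l.
- exact: dist_sym.
- exact: dist_eq0.
- by move=> g u y; rewrite -hF (same_array_nbr_sum hde harr).
- by move=> z xz; apply: v_out; rewrite inE.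
- move=> y xy; rewrite -v_eig ?inE ?xy //.
  by apply: eq_bigl => z; rewrite dist_eq1.
Qed.
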